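(* Suppose $\alpha\in\mathbb{D}^{\mathbb{Z}}$ is bounded away from $\partial\mathbb{D}$ (i.e. $\|\alpha\|_\infty<1$) and that there exist positive integers $n_k\to\infty$ such that $$\alpha(j-n_k)=\alpha(j)=\alpha(j+n_k)\quad\text{for all } 0\le j\le n_k-1$$ and all $k$. Then the extended CMV matrix $\mathcal{E}_\alpha$ has purely continuous spectrum (that is, it has no eigenvalues).
   Context: $\mathbb{D} = \{z \in \mathbb{C} : |z|<1\}$ and $\alpha(n)=\alpha_n$. Given $\alpha = (\alpha_n)_{n\in\mathbb{Z}}$ with $\alpha_n \in \mathbb{D}$ (the Verblunsky coefficients), the corresponding extended CMV matrix is the unitary operator $\mathcal{E}_\alpha = \mathcal{L}\mathcal{M}$ on $\ell^2(\mathbb{Z})$, where $$\mathcal{L} = \bigoplus_{j\in\mathbb{Z}} \Theta(\alpha_{2j}),\quad \mathcal{M} = \bigoplus_{j\in\mathbb{Z}} \Theta(\alpha_{2j+1}),\quad \Theta(\alpha) = \begin{pmatrix} \overline{\alpha} & \rho \\ \rho & -\alpha\end{pmatrix},\quad \rho = \sqrt{1-|\alpha|^2},$$ and $\Theta(\alpha_n)$ acts on $\ell^2(\{n,n+1\})$. *)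

(* Defs.v *)
From HB Require Import structures.
From mathcomp Require Import all_boot all_order all_algebra.
From mathcomp Require Import complex.
From mathcomp Require Import all_classical all_reals all_analysis.

Set Implicit Arguments.
Unset Strict Implicit.
Unset Printing Implicit Defensive.

Import Order.TTheory GRing.Theory Num.Theory.
Import Normc.

Local Open Scope classical_set_scope.
Local Open Scope ring_scope.
Local Open Scope complex_scope.

(* [normc z : R] is the real-valued modulus of [z : R[i]]. *)
Definition open_unit_disk (R : realType) : set R[i] := [set z | normc z < 1].

(* Meaningful for bounded sequences, in particular for sequences in the unit
   disk ([sup] of an unbounded set is 0). *)
Definition sup_norm (R : realType) (a : int -> R[i]) : R :=
  sup [set normc (a n) | n in [set: int]].

Definition rho (R : realType) (a : R[i]) : R := Num.sqrt (1 - normc a ^+ 2).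

Definition Theta (R : realType) (a : R[i]) : 'M[R[i]]_2 :=
  \matrix_(i, j)
    if i == 0 then (if j == 0 then a^* else (rho a)%:C)
    else (if j == 0 then (rho a)%:C else - a).

Definition pair_at (R : realType) (u : int -> R[i]) (n : int) : 'cV[R[i]]_2 :=
  \col_(i < 2) u (n + (i : nat)%:Z).

(* The direct sum of the blocks [A n], [n] even, where [A n] acts on the
   coordinates [n] and [n + 1]: the coordinate [k] of the image lies in the block
   starting at [k] if [k] is even, and at [k - 1] if [k] is odd. *)
Definition even_block_sum (R : realType) (A : int -> 'M[R[i]]_2)
    (u : int -> R[i]) : int -> R[i] :=
  fun k => if (2 %| k)%Z then (A k *m pair_at u k) 0 0
           else (A (k - 1) *m pair_at u (k - 1)) 1 0.

(* The same with [n] odd. *)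
Definition odd_block_sum (R : realType) (A : int -> 'M[R[i]]_2)
    (u : int -> R[i]) : int -> R[i] :=
  fun k => if (2 %| k)%Z then (A (k - 1) *m pair_at u (k - 1)) 1 0
           else (A k *m pair_at u k) 0 0.

Definition CMV_L (R : realType) (alpha : int -> R[i]) :
    (int -> R[i]) -> (int -> R[i]) :=
  even_block_sum (fun n => Theta (alpha n)).

Definition CMV_M (R : realType) (alpha : int -> R[i]) :
    (int -> R[i]) -> (int -> R[i]) :=
  odd_block_sum (fun n => Theta (alpha n)).

(* L and M are band operators, so their formulas make sense on all two-sided
   sequences; the operator on l^2(Z) is the restriction to [ell2Z], to which the
   notions of eigenvector and point spectrum below refer. *)
Definition extended_CMV (R : realType) (alpha : int -> R[i]) :
    (int -> R[i]) -> (int -> R[i]) :=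
  CMV_L alpha \o CMV_M alpha.

Definition ell2Z (R : realType) : set (int -> R[i]) :=
  [set u | (\esum_(n in [set: int]) ((normc (u n) ^+ 2)%:E : \bar R) < +oo)%E].

Definition is_eigenvector (R : realType)
    (T : (int -> R[i]) -> (int -> R[i])) (z : R[i]) (u : int -> R[i]) : Prop :=
  [/\ ell2Z u, exists n, u n != 0 & forall n, T u n = z * u n].

Definition point_spectrum (R : realType)
    (T : (int -> R[i]) -> (int -> R[i])) : set R[i] :=
  [set z | exists u, is_eigenvector T z u].

Definition purely_continuous_spectrum (R : realType)
    (T : (int -> R[i]) -> (int -> R[i])) : Prop :=
  point_spectrum T = set0.

(* Main.v *)
(** Gordon's three-block argument.  If [u] is an eigenvector for [z], put
    [v := M u], so that [L v = z u], and [s := sqrt z] (the case [z = 0] is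
    excluded since [L] and [M] are injective).  The vectors [(v n, s * u n)] for
    even [n] and [(s * u n, v n)] for odd [n] evolve by the Szego matrices
    [rho^-1 [[s^-1, - a], [- a^*, s]]], [a = alpha n], of determinant 1; the
    swap of the coordinates makes the step independent of the parity of [n],
    so that odd repetition lengths need no separate treatment.  With [T] the
    transfer matrix over a block of length [n = n_ k], the vectors at [- n],
    [0], [n], [2n] are consecutive iterates of [T], and [T^2 - (tr T) T + 1 = 0]
    prevents those at [- n], [n], [2n] from all being small compared with the
    one at [0].  As [u] is square summable, they tend to 0 with [k], hence the
    solution vanishes. *)
Require Import Defs.
From HB Require Import structures.
From mathcomp Require Import all_boot all_order all_algebra.
From mathcomp Require Import complex.
From mathcomp Require Import all_classical all_reals all_analysis.
From mathcomp Require Import zify ring.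

Import Order.TTheory GRing.Theory Num.Theory.
Import Normc.

Local Open Scope classical_set_scope.
Local Open Scope ring_scope.
Local Open Scope complex_scope.

(** * Two-by-two matrices and transfer matrices *)

Lemma ord2E (i : 'I_2) : i = 0 \/ i = 1.
Proof. by case: i => [[|[|//]]] ?; [left|right]; apply/val_inj. Qed.

Lemma det_mx2 (K : comNzRingType) (A : 'M[K]_2) :
  \det A = A 0 0 * A 1 1 - A 0 1 * A 1 0.
Proof.
rewrite (expand_det_row A 0) !big_ord_recl big_ord0 /cofactor.
rewrite !det_mx11 !mxE /= addr0 expr0 expr1 mul1r mulN1r mulrN.
by congr (A _ _ * A _ _ - A _ _ * A _ _); apply/val_inj.
Qed.

(** Cayley-Hamilton in size 2, checked entry by entry. *)
Lemma mulmx2_sqr (K : comNzRingType) (A : 'M[K]_2) :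
  A *m A = \tr A *: A - (\det A)%:M.
Proof.
apply/matrixP => i j; rewrite det_mx2 /mxtrace !mxE !big_ord_recl !big_ord0.
have -> : lift ord0 ord0 = 1 :> 'I_2 by apply/val_inj.
by case: (ord2E i) => ->; case: (ord2E j) => -> /=;
  rewrite ?mulr1n ?mulr0n; ring.
Qed.

Fixpoint transfer (K : comNzRingType) (S : int -> 'M[K]_2) (m : int) (n : nat)
    : 'M[K]_2 :=
  if n is k.+1 then S (m + k%:Z) *m transfer K S m k else 1%:M.

Lemma det_transfer (K : comNzRingType) (S : int -> 'M[K]_2) :
  (forall n, \det (S n) = 1) -> forall m n, \det (transfer K S m n) = 1.
Proof.
move=> detS m; elim=> [|n IHn] /=; first exact: det1.
by rewrite det_mulmx detS IHn mulr1.
Qed.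

Lemma eq_transfer (K : comNzRingType) (S : int -> 'M[K]_2)
    (l m : int) (n : nat) :
  (forall k : nat, (k < n)%N -> S (l + k%:Z) = S (m + k%:Z)) ->
  transfer K S l n = transfer K S m n.
Proof.
elim: n => [//|n IHn] eqS /=; rewrite eqS // IHn // => k ltkn.
by apply: eqS; apply: ltnW.
Qed.

Lemma transferE (K : comNzRingType) (S : int -> 'M[K]_2) (Y : int -> 'cV[K]_2) :
  (forall n, Y (n + 1) = S n *m Y n) ->
  forall m n, Y (m + n%:Z) = transfer K S m n *m Y m.
Proof.
move=> YS m; elim=> [|n IHn] /=; first by rewrite addr0 mul1mx.
by rewrite -mulmxA -IHn -YS -addrA -[n.+1]addn1.
Qed.

Lemma transfer_eq0 (K : comUnitRingType) (S : int -> 'M[K]_2)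
    (Y : int -> 'cV[K]_2) :
  (forall n, Y (n + 1) = S n *m Y n) -> (forall n, \det (S n) = 1) ->
  Y 0 = 0 -> forall n, Y n = 0.
Proof.
move=> YS detS Y0 [n|n].
  by rewrite -[Posz n]add0r (transferE _ _ _ YS) Y0 mulmx0.
(* Backward propagation: the [n.+1] steps from [Negz n] end at 0, and their transfer matrix is
   invertible since its determinant is 1. *)
have := transferE _ _ _ YS (Negz n) n.+1.
set T := transfer _ _ _ _.
rewrite NegzE addNr Y0 => /esym/(congr1 (mulmx (invmx T))).
by rewrite mulmx0 mulKmx // unitmxE det_transfer // unitr1.
Qed.

(** The repetition gives the blocks starting at [- n], 0 and [n] the same transfer matrix [T]. With
    [t] the trace of [T], Cayley-Hamilton applied to [Y 0] and to [Y (- n)] yields the two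
    identities. *)
Lemma gordon_identity (K : comNzRingType) (S : int -> 'M[K]_2)
    (Y : int -> 'cV[K]_2) (n : nat) :
  (forall m, Y (m + 1) = S m *m Y m) -> (forall m, \det (S m) = 1) ->
  (forall j : int, 0 <= j <= n%:Z - 1 ->
     S (j - n%:Z) = S j /\ S j = S (j + n%:Z)) ->
  exists t : K, Y (n + n)%:Z = t *: Y n - Y 0 /\ Y n = t *: Y 0 - Y (- n%:Z).
Proof.
move=> YS detS perS; set T := transfer K S 0 n.
have Tr : transfer K S n n = T.
  apply: eq_transfer => k ltkn; rewrite add0r addrC; apply/esym.
  by case: (perS k) => //; lia.
have Tl : transfer K S (- n%:Z) n = T.
  apply: eq_transfer => k ltkn; rewrite add0r addrC.
  by case: (perS k) => //; lia.
have Y0n : Y n = T *m Y 0 by rewrite -(transferE _ _ _ YS) add0r.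
have Yl0 : Y 0 = T *m Y (- n%:Z) by rewrite -Tl -(transferE _ _ _ YS) addNr.
have Y2n : Y (n + n)%:Z = T *m Y n by rewrite PoszD (transferE _ _ _ YS) Tr.
have CH := mulmx2_sqr _ T; rewrite det_transfer // in CH.
exists (\tr T); split.
  by rewrite Y2n Y0n mulmxA CH mulmxBl mul1mx scalemxAl.
by rewrite Y0n [in LHS]Yl0 mulmxA CH mulmxBl mul1mx -scalemxAl -Yl0.
Qed.

(** * Decay at infinity and Gordon's argument *)

(** Over [R[i]] the order is partial and [0 < e] forces [e] to be real, so this is the usual
    limit. *)
Definition vanishes_at_infty (K : numDomainType) (f : int -> K) : Prop :=
  forall e : K, 0 < e ->
    exists N : nat, forall m : int, (N <= `|m|)%N -> `|f m| < e.

Lemma vanishes_at_inftyD (K : numFieldType) (f g : int -> K) :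
  vanishes_at_infty K f -> vanishes_at_infty K g ->
  vanishes_at_infty K (fun n => f n + g n).
Proof.
move=> f0 g0 e e0; have e20 : 0 < e / 2 by rewrite divr_gt0.
have [N fN] := f0 _ e20; have [N' gN] := g0 _ e20.
exists (maxn N N') => m; rewrite geq_max => /andP[/fN fm /gN gm].
by rewrite (le_lt_trans (ler_normD _ _)) // [e]splitr ltrD.
Qed.

Lemma vanishes_at_inftyMl (K : numFieldType) (c : K) (f : int -> K) :
  vanishes_at_infty K f -> vanishes_at_infty K (fun n => c * f n).
Proof.
move=> f0 e e0; have c1 : 0 < `|c| + 1 by rewrite ltr_wpDl.
have [N fN] := f0 _ (divr_gt0 e0 c1); exists N => m /fN.
rewrite ltr_pdivlMr // => /(le_lt_trans _); apply.
by rewrite normrM mulrC ler_wpM2l // lerDl.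
Qed.

Lemma vanishes_at_infty_shift (K : numDomainType) (p : int) (f : int -> K) :
  vanishes_at_infty K f -> vanishes_at_infty K (fun n => f (n + p)).
Proof.
move=> f0 e e0; have [N fN] := f0 _ e0; exists (N + `|p|)%N => m Nm.
by apply: fN; lia.
Qed.

Lemma vanishes_at_infty_le (K : numDomainType) (f g : int -> K) :
  (forall n, `|f n| <= `|g n|) ->
  vanishes_at_infty K g -> vanishes_at_infty K f.
Proof.
move=> fg g0 e e0; have [N gN] := g0 _ e0.
by exists N => m /gN; apply: le_lt_trans.
Qed.

Lemma vanishes_at_infty_norm (K : numDomainType) (f : int -> K) :
  vanishes_at_infty K f -> vanishes_at_infty K (fun n => `|f n|).
Proof. by apply: vanishes_at_infty_le => n; rewrite normr_id. Qed.

(** The scalar [t] of [gordon_identity] is the same for both coordinates, so one nonzero coordinate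
    of [Y 0] can be followed alone, without a norm on vectors. *)
Lemma gordon_lemma (K : numFieldType) (S : int -> 'M[K]_2)
    (Y : int -> 'cV[K]_2) (n_ : nat -> nat) :
  (forall m, Y (m + 1) = S m *m Y m) -> (forall m, \det (S m) = 1) ->
  (forall N, exists k, (N <= n_ k)%N) ->
  (forall k (j : int), 0 <= j <= (n_ k)%:Z - 1 ->
     S (j - (n_ k)%:Z) = S j /\ S j = S (j + (n_ k)%:Z)) ->
  (forall i, vanishes_at_infty K (fun n => Y n i 0)) ->
  forall n, Y n = 0.
Proof.
move=> YS detS n_unbdd perS Yinfty; apply: transfer_eq0 (YS) (detS) _.
apply/matrixP => i j; rewrite ord1 mxE; apply/eqP; apply: contraT => Y0.
have e0 : 0 < `|Y 0 i 0| / 2 by rewrite divr_gt0 ?normr_gt0.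
have [N YN] := Yinfty i _ e0; have [k Nk] := n_unbdd N.
have [t [/matrixP/(_ i 0) + /matrixP/(_ i 0)]] :=
  gordon_identity _ _ _ _ YS detS (perS k).
rewrite !mxE => Y2n Yn; set n := n_ k in Nk Y2n Yn.
have ltn := YN n Nk.
have lt2n : `|Y (n + n)%:Z i 0| < `|Y 0 i 0| / 2 by apply: YN; lia.
have ltNn : `|Y (- n%:Z) i 0| < `|Y 0 i 0| / 2 by apply: YN; lia.
suff : `|Y 0 i 0| < `|Y 0 i 0| / 2 + `|Y 0 i 0| / 2 by rewrite -splitr ltxx.
(* If [t] has modulus at most 1, [Y 0] is controlled by [Y n] and [Y (n + n)]; otherwise [Y 0] is no
   larger than [t *: Y 0], which is the sum of [Y n] and [Y (- n)]. *)
have [t1|t1] := real_leP (normr_real t) (real1 K).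
  have {1}-> : Y 0 i 0 = t * Y n i 0 - Y (n + n)%:Z i 0 by rewrite Y2n; ring.
  rewrite (le_lt_trans (ler_normB _ _)) // ltr_leD // 1?ltW // normrM.
  by rewrite (le_lt_trans _ ltn) // ler_piMl.
apply: (@le_lt_trans _ _ (`|t| * `|Y 0 i 0|)); first by rewrite ler_peMl // ltW.
have tY0 : t * Y 0 i 0 = Y n i 0 + Y (- n%:Z) i 0 by rewrite Yn; ring.
rewrite -normrM tY0.
by rewrite (le_lt_trans (ler_normD _ _)) // ltrD.
Qed.

(** A summable family of squares has only finitely many terms of modulus at least a given
    [r > 0]. *)
Lemma ell2Z_vanishes_at_infty (R : realType) (u : int -> R[i]) :
  ell2Z u -> vanishes_at_infty R[i] u.
Proof.
rewrite /ell2Z /= => usum e e0.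
have eE : (complex.Re e)%:C = e by apply/RRe_real/gtr0_real.
set r := complex.Re e in eE.
have r0 : 0 < r by rewrite -ltcR eE.
pose A := [set n | r <= normc (u n)].
have finA : finite_set A.
  apply: contrapT => infA.
  set s := (\esum_(n in _) _)%E in usum.
  have s0 : (0 <= s)%E by apply: esum_ge0 => n _; rewrite lee_fin sqr_ge0.
  have sfin : s \is a fin_num by rewrite ge0_fin_numE.
  (* More than [s / r ^+ 2] indices, each contributing at least [r ^+ 2], would push a finite
     partial sum above [s]. *)
  have [B BA sizeB] := infinite_set_fset (Num.trunc (fine s / r ^+ 2)).+1 infA.
  have uniqB := finmap.fset_uniq B; set l := finmap.enum_fset B in sizeB uniqB.
  have : (\sum_(n \in [set` l]) (normc (u n) ^+ 2)%:E <= s)%E.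
    by apply: esum_ge; exists [set` l] => //; split=> //; exact: finite_seq.
  rewrite -fsbig_seq // sumEFin -[s]fineK // lee_fin leNgt => /negP; apply.
  have := truncnS_gt (fine s / r ^+ 2).
  rewrite ltr_pdivrMr ?exprn_gt0 // => /lt_le_trans; apply.
  apply: (@le_trans _ _ (\sum_(n <- l) r ^+ 2)).
    rewrite big_const_seq count_predT iter_addr_0 -[leRHS]mulr_natl.
    by rewrite ler_wpM2r ?sqr_ge0 // ler_nat.
  rewrite big_seq [leRHS]big_seq; apply: ler_sum => n /BA /= rn.
  by rewrite lerXn2r // nnegrE ?(ltW r0) // (le_trans (ltW r0)).
have [s As] := (finite_seqP A).1 finA.
exists (\max_(n <- s) `|n|%N).+1 => m mN.
rewrite -eE -[`|_|]/((normc _)%:C) ltcR ltNge; apply/negP => rm.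
have : A m by [].
rewrite As /= => ms.
have := leq_bigmax_seq (P := xpredT) (F := fun n : int => `|n|%N) m ms isT.
by rewrite leqNgt mN.
Qed.

(** * The blocks [Theta] and the factors L and M *)

Lemma normc_ge0 (R : realType) (z : R[i]) : 0 <= normc z.
Proof. by case: z => x y; apply: sqrtr_ge0. Qed.

Lemma disk_rho_gt0 (R : realType) (a : R[i]) : open_unit_disk a -> 0 < rho a.
Proof.
rewrite /open_unit_disk /= => a1; rewrite sqrtr_gt0 subr_gt0 expr_lt1 //.
exact: normc_ge0.
Qed.

Lemma disk_sqr_rho (R : realType) (a : R[i]) :
  open_unit_disk a -> (rho a)%:C ^+ 2 = 1 - a * a^*.
Proof.
rewrite /open_unit_disk /= => a1; rewrite -rmorphXn /= sqr_sqrtr.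
  by rewrite rmorphB rmorph1 rmorphXn /= -sqr_normc.
by rewrite subr_ge0 expr_le1 ?normc_ge0 // ltW.
Qed.

Lemma det_Theta (R : realType) (a : R[i]) :
  open_unit_disk a -> \det (Theta a) = -1.
Proof.
by move=> /disk_sqr_rho a1; rewrite det_mx2 !mxE /= -expr2 a1; ring.
Qed.

Lemma pair_at0 (R : realType) (u : int -> R[i]) (n : int) :
  pair_at u n 0 0 = u n.
Proof. by rewrite mxE addr0. Qed.

Lemma pair_at1 (R : realType) (u : int -> R[i]) (n : int) :
  pair_at u n 1 0 = u (n + 1).
Proof. by rewrite mxE. Qed.

Lemma Theta_mul0 (R : realType) (a : R[i]) (u : int -> R[i]) (n : int) :
  (Theta a *m pair_at u n) 0 0 = a^* * u n + (rho a)%:C * u (n + 1).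
Proof.
by rewrite mxE !big_ord_recl big_ord0 !mxE /= !addr0.
Qed.

Lemma Theta_mul1 (R : realType) (a : R[i]) (u : int -> R[i]) (n : int) :
  (Theta a *m pair_at u n) 1 0 = (rho a)%:C * u n - a * u (n + 1).
Proof.
by rewrite mxE !big_ord_recl big_ord0 !mxE /= !addr0 mulNr.
Qed.

Lemma pair_at_even_block_sum (R : realType) (A : int -> 'M[R[i]]_2)
    (u : int -> R[i]) (n : int) :
  (2 %| n)%Z -> pair_at (even_block_sum A u) n = A n *m pair_at u n.
Proof.
move=> n2; have n12 : (2 %| n + 1)%Z = false by apply/negbTE; lia.
by apply/colP => i; case: (ord2E i) => ->;
  rewrite ?pair_at0 ?pair_at1 /even_block_sum ?n2 ?n12 // addrK.
Qed.

Lemma pair_at_odd_block_sum (R : realType) (A : int -> 'M[R[i]]_2)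
    (u : int -> R[i]) (n : int) :
  ~~ (2 %| n)%Z -> pair_at (odd_block_sum A u) n = A n *m pair_at u n.
Proof.
move=> n2; have n12 : (2 %| n + 1)%Z by lia.
by apply/colP => i; case: (ord2E i) => ->;
  rewrite ?pair_at0 ?pair_at1 /odd_block_sum ?(negbTE n2) ?n12 // addrK.
Qed.

Lemma Theta_ker (R : realType) (a : R[i]) (x : 'cV[R[i]]_2) :
  open_unit_disk a -> Theta a *m x = 0 -> x = 0.
Proof.
move=> /det_Theta detT /(congr1 (mulmx (invmx (Theta a)))).
by rewrite mulmx0 mulKmx // unitmxE detT unitrN unitr1.
Qed.

(** Each block is invertible, and the pairs starting at even indices cover [int]. With its analogue
    for M, this excludes the eigenvalue 0. *)
Lemma CMV_L_inj0 (R : realType) (alpha u : int -> R[i]) :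
  (forall n, open_unit_disk (alpha n)) ->
  (forall n, CMV_L alpha u n = 0) -> forall n, u n = 0.
Proof.
move=> adisk Lu0.
have pair0 n : (2 %| n)%Z -> pair_at u n = 0.
  move=> n2; apply: (Theta_ker _ _ _ (adisk n)).
  rewrite -(pair_at_even_block_sum _ (fun k => Theta (alpha k))) //.
  by apply/colP => i; rewrite !mxE; exact: Lu0.
move=> n; case: (boolP (2 %| n)%Z) => n2.
  by rewrite -pair_at0 pair0 // mxE.
by rewrite -[n](subrK 1) -pair_at1 pair0 ?mxE //; lia.
Qed.

Lemma CMV_M_inj0 (R : realType) (alpha u : int -> R[i]) :
  (forall n, open_unit_disk (alpha n)) ->
  (forall n, CMV_M alpha u n = 0) -> forall n, u n = 0.
Proof.
move=> adisk Mu0.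
have pair0 n : ~~ (2 %| n)%Z -> pair_at u n = 0.
  move=> n2; apply: (Theta_ker _ _ _ (adisk n)).
  rewrite -(pair_at_odd_block_sum _ (fun k => Theta (alpha k))) //.
  by apply/colP => i; rewrite !mxE; exact: Mu0.
move=> n; case: (boolP (2 %| n)%Z) => n2.
  by rewrite -[n](subrK 1) -pair_at1 pair0 ?mxE //; lia.
by rewrite -pair_at0 pair0 // mxE.
Qed.

Lemma CMV_M_vanishes_at_infty (R : realType) (alpha u : int -> R[i]) :
  (forall n, open_unit_disk (alpha n)) ->
  vanishes_at_infty R[i] u -> vanishes_at_infty R[i] (CMV_M alpha u).
Proof.
move=> adisk u0.
have rho1 n : `|(rho (alpha n))%:C : R[i]| <= 1.
  rewrite -[`|_|]/((normc _)%:C) -[1]/(1%:C) lecR /= expr0n /= addr0.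
  rewrite sqr_sqrtr; last first.
    by rewrite subr_ge0 expr_le1 ?normc_ge0 // ltW //; exact: adisk.
  by rewrite -[leRHS]sqrtr1 ler_sqrt // gerBl sqr_ge0.
have alpha1 n : `|alpha n| <= 1.
  by rewrite -[`|_|]/((normc _)%:C) -[1]/(1%:C) lecR ltW //; exact: adisk.
(* Entry [n] of [M u] involves [u n] and one neighbour, on a side depending on parity, with
   coefficients of modulus at most 1; keeping both neighbours gives a bound uniform in parity. *)
pose g n := `|u (n - 1)| + `|u n| + `|u (n + 1)|.
apply: (@vanishes_at_infty_le _ _ g); last first.
  apply: vanishes_at_inftyD; first apply: vanishes_at_inftyD.
  1-3: by apply: vanishes_at_infty_norm => //; apply: vanishes_at_infty_shift.
move=> n; rewrite /g [leRHS]ger0_norm ?addr_ge0 // /CMV_M /odd_block_sum.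
case: ifP => _; rewrite ?Theta_mul0 ?Theta_mul1 ?subrK.
  apply: (le_trans (ler_normB _ _)); rewrite !normrM -[leLHS]addr0.
  by apply: lerD => //; apply: lerD; exact: ler_piMl.
apply: (le_trans (ler_normD _ _)); rewrite !normrM normcJ -addrA -[leLHS]add0r.
by apply: lerD => //; apply: lerD; exact: ler_piMl.
Qed.

(** * The Szego recursion *)

Definition szego (R : realType) (s a : R[i]) : 'M[R[i]]_2 :=
  (rho a)%:C^-1 *: \matrix_(i, j)
    if i == 0 then (if j == 0 then s^-1 else - a)
    else (if j == 0 then - a^* else s).

Definition szego_state (R : realType) (s : R[i]) (u v : int -> R[i]) (n : int) :
    'cV[R[i]]_2 :=
  \col_(i < 2) if (2 %| n)%Z == (i == 0) then v n else s * u n.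

(** The diagonal entries [s^-1] and [s] multiply to 1, leaving [1 - a * a^*], which the prefactor
    squared cancels. *)
Lemma det_szego (R : realType) (s a : R[i]) :
  s != 0 -> open_unit_disk a -> \det (szego R s a) = 1.
Proof.
move=> s0 adisk; have a2 := disk_sqr_rho _ _ adisk.
have r0 : (rho a)%:C != 0 by rewrite fmorph_eq0 gt_eqF // disk_rho_gt0.
rewrite det_mx2 !mxE /=; apply: (mulfI (expf_neq0 2 r0)).
by rewrite mulr1 [RHS]a2; field; rewrite r0.
Qed.

(** Write (x, y) for the state at [n] and (x', y') for the next one. For either parity, the block
    equation at [n] says that [Theta a] sends (x, y') to s (y, x'); solving it for (x', y') gives
    the Szego matrix. *)
Lemma szego_step (R : realType) (s : R[i]) (alpha u : int -> R[i]) :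
  s != 0 -> (forall n, open_unit_disk (alpha n)) ->
  (forall n, extended_CMV alpha u n = s ^+ 2 * u n) ->
  forall n, szego_state R s u (CMV_M alpha u) (n + 1) =
    szego R s (alpha n) *m szego_state R s u (CMV_M alpha u) n.
Proof.
move=> s0 adisk Eu n; set v := CMV_M alpha u; set a := alpha n.
have r0 : (rho a)%:C != 0.
  by rewrite fmorph_eq0 gt_eqF //; exact: (disk_rho_gt0 _ _ (adisk n)).
have a2 := disk_sqr_rho _ _ (adisk n); rewrite -/a in a2.
have solve (x y x' y' : R[i]) : s * y = a^* * x + (rho a)%:C * y' ->
    s * x' = (rho a)%:C * x - a * y' ->
    x' = (rho a)%:C^-1 * (s^-1 * x - a * y) /\
    y' = (rho a)%:C^-1 * (s * y - a^* * x).
  move=> Ey Ex.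
  have y'E : y' = (rho a)%:C^-1 * (s * y - a^* * x) by rewrite Ey; field.
  split=> //; apply: (mulfI s0); rewrite Ex y'E.
  apply: (mulfI r0).
  transitivity ((rho a)%:C ^+ 2 * x - a * (s * y - a^* * x)); first by field.
  by rewrite a2; field; rewrite s0.
have colE (x y : R[i]) (Y : 'cV_2) (x' y' : R[i]) (Y' : 'cV_2) :
    Y 0 0 = x -> Y 1 0 = y -> Y' 0 0 = x' -> Y' 1 0 = y' ->
    s * y = a^* * x + (rho a)%:C * y' -> s * x' = (rho a)%:C * x - a * y' ->
    Y' = szego R s a *m Y.
  move=> <- <- <- <- Ey Ex; have [Ex' Ey'] := solve _ _ _ _ Ey Ex.
  apply/colP => i; rewrite mxE !big_ord_recl big_ord0 /= !mxE.
  have -> : lift ord0 ord0 = 1 :> 'I_2 by apply/val_inj.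
  by case: (ord2E i) => -> /=; [rewrite Ex'|rewrite Ey']; ring.
(* For even [n] the block equation comes from [L v = s ^+ 2 * u]. *)
have [n2|n2] := boolP (2 %| n)%Z.
  have n12 : (2 %| n + 1)%Z = false by apply/negbTE; lia.
  have := pair_at_even_block_sum _ (fun n => Theta (alpha n)) v _ n2.
  move=> /matrixP E; have := E 0 0; have := E 1 0.
  rewrite Theta_mul0 Theta_mul1 pair_at0 pair_at1 => E1 E0.
  have := Eu n; have := Eu (n + 1).
  rewrite /extended_CMV /= /CMV_L E0 E1 => E1' E0'.
  apply: (colE (v n) (s * u n) _ (s * u (n + 1)) (v (n + 1)));
    rewrite ?mxE ?n2 ?n12 //.
    by rewrite mulrA -expr2 -E0'.
  by rewrite mulrA -expr2 -E1'.
(* For odd [n] it is the definition [v = M u], multiplied by [s]. *)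
have n12 : (2 %| n + 1)%Z by lia.
have := pair_at_odd_block_sum _ (fun n => Theta (alpha n)) u _ n2.
move=> /matrixP E; have := E 0 0; have := E 1 0.
rewrite Theta_mul0 Theta_mul1 pair_at0 pair_at1 -/(CMV_M alpha u) => E1 E0.
apply: (colE (s * u n) (v n) _ (v (n + 1)) (s * u (n + 1)));
  rewrite ?mxE ?(negbTE n2) ?n12 //.
  by rewrite [v n]E0 -/a; ring.
by rewrite [v (n + 1)]E1 -/a; ring.
Qed.

(** * Exclusion of eigenvalues *)

Theorem theorem1p4 (R : realType) (alpha : int -> R[i])
    (alpha_disk : forall n : int, open_unit_disk (alpha n))
    (alpha_bdd : sup_norm alpha < 1)
    (n_ : nat -> nat)
    (n_gt0 : forall k : nat, (0 < n_ k)%N)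
    (n_infty : n_ k @[k --> \oo] --> \oo)
    (alpha_rep : forall (k : nat) (j : int), 0 <= j <= (n_ k)%:Z - 1 ->
       alpha (j - (n_ k)%:Z) = alpha j /\ alpha j = alpha (j + (n_ k)%:Z)) :
  purely_continuous_spectrum (extended_CMV alpha).
Proof.
rewrite /purely_continuous_spectrum -subset0 => z [u [uell2 [m um0] Eu]] /=.
have [z0|z0] := eqVneq z 0.
  move/eqP: um0; apply.
  apply: (CMV_M_inj0 _ _ _ alpha_disk).
  apply: (CMV_L_inj0 _ _ _ alpha_disk) => n.
  by rewrite -[LHS]/(extended_CMV alpha u n) Eu z0 mul0r.
pose s := sqrtC z; have s2 : z = s ^+ 2 by rewrite sqrtCK.
have s0 : s != 0 by rewrite sqrtC_eq0.
have u_infty := ell2Z_vanishes_at_infty _ _ uell2.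
have v_infty := CMV_M_vanishes_at_infty _ _ _ alpha_disk u_infty.
have Y0 : forall n, szego_state R s u (CMV_M alpha u) n = 0.
  apply: (gordon_lemma _ (fun n => szego R s (alpha n)) _ n_).
  - by apply: szego_step => // n; rewrite Eu s2.
  - by move=> n; apply: det_szego.
  - move=> N; have /cvgnyPge/(_ N) [k _ kN] := n_infty.
    by exists k; apply: kN => /=.
  - by move=> k j /alpha_rep[-> <-].
  (* A fixed coordinate [i] alternates between [M u] and [s * u] as [n] changes parity; [g]
     dominates both. *)
  - move=> i; pose g n := `|CMV_M alpha u n| + `|s * u n|.
    apply: (@vanishes_at_infty_le _ _ g).
      move=> n; rewrite mxE /g [leRHS]ger0_norm ?addr_ge0 //.
      by case: ifP => _; rewrite ?lerDl ?lerDr.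
    apply: (vanishes_at_inftyD R[i]); apply: vanishes_at_infty_norm => //.
    exact: (vanishes_at_inftyMl R[i]).
(* This index selects the coordinate of the state at [m] that holds [s * u m]. *)
have /matrixP/(_ (if (2 %| m)%Z then 1 else 0) 0) := Y0 m.
rewrite !mxE; case: ifP => [/eqP|_ /eqP]; first by case: (2 %| m)%Z.
by rewrite mulf_eq0 (negbTE s0) (negbTE um0).
Qed.
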